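(* Let $\mathfrak{f}(n)=|\mathrm{Cay}[n]|$ be the number of Cayley permutations of $[n]$ (the $n$th Fubini number) and let $|\mathrm{Cay}_{\mathrm{Der}}[n]|$ be the number of fixed-point-free Cayley permutations of $[n]$. Then $$\lim_{n\to\infty}\frac{|\mathrm{Cay}_{\mathrm{Der}}[n]|}{\mathfrak{f}(n)}=\frac1e .$$
   Context: $[n]=\{1,\dots,n\}$. A Cayley permutation of $[n]$ is a function $f:[n]\to[n]$ with $\mathrm{Im}(f)=[k]$ for some $k\le n$; it is fixed-point-free if $f(u)\neq u$ for all $u\in[n]$. *)

(* Defs.v *)
From mathcomp Require Import all_boot.

Set Implicit Arguments.
Unset Strict Implicit.
Unset Printing Implicit Defensive.

(* The set [n] = {1, ..., n} is encoded as 'I_n = {0, ..., n-1}, shifting both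
   the domain and the codomain by one: [k] becomes {j : 'I_n | j < k}, and
   the condition f(u) <> u is unaffected. *)
Definition is_cayley (n : nat) (f : {ffun 'I_n -> 'I_n}) : bool :=
  [exists k : 'I_n.+1, f @: [set: 'I_n] == [set j : 'I_n | j < k]].

Definition Cay (n : nat) : {set {ffun 'I_n -> 'I_n}} :=
  [set f | is_cayley f].

Definition fixed_point_free (n : nat) (f : {ffun 'I_n -> 'I_n}) : bool :=
  [forall u, f u != u].

Definition CayDer (n : nat) : {set {ffun 'I_n -> 'I_n}} :=
  [set f in Cay n | fixed_point_free f].

Definition fubini (n : nat) : nat := #|Cay n|.

(* Main.v *)
(* Right composition with a permutation preserves Cayley permutations, so
   n! |CayDer n| counts the pairs (f, s) of a Cayley permutation f and a
   permutation s that disagree everywhere. Inclusion-exclusion over the subsets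
   A of [n] on which f and s agree gives
     n! |CayDer n| = sum_A (-1)^|A| (n - |A|)! #{f in Cay n injective on A}.
   At most a proportion 1/n of the Cayley permutations satisfy f a = f b for
   given a <> b, so all but a proportion |A| (|A| - 1) / n of them are injective
   on A; replacing the last factor by |Cay n| turns |CayDer n| / |Cay n| into
   sum_(j <= n) (-1)^j / j!, with an error of at most
   (1 / n) sum_(j <= n) j (j - 1) / j! <= e / n. *)
Require Import Defs.
From mathcomp Require Import all_boot all_order all_algebra all_fingroup.
From mathcomp Require Import all_classical all_reals all_analysis.
From mathcomp Require Import ring.
Import Order.TTheory GRing.Theory Num.Theory.
Import numFieldNormedType.Exports.

(** * Permutations extending a partial injection *)

Lemma perm_extending (T : finType) (A : {set T}) (f : T -> T) :
  {in A &, injective f} -> exists s : {perm T}, {in A, f =1 s}.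
Proof.
have [m] := ubnP #|A|; elim: m A => // m IHm A leAm injf.
have [->|[x Ax]] := set_0Vmem A; first by exists 1%g => y; rewrite inE.
have [||s fs] := IHm (A :\ x).
- by rewrite (cardsD1 x) Ax in leAm.
- by move=> y z /setD1P[_ Ay] /setD1P[_ Az]; apply: injf.
(* [s] acts first; the transposition then corrects the value at [x]. It fixes [f y] for the other
   [y] in [A], since [f y = s y] differs from [s x] and from [f x] by injectivity. *)
exists (s * tperm (s x) (f x))%g => y Ay; rewrite permM.
have [->|neq_yx] := eqVneq y x; first by rewrite tpermL.
have fy : f y = s y by apply: fs; rewrite !inE neq_yx.
rewrite tpermD ?fy // -?fy; last first.
  by apply: contra_neq neq_yx => fxy; apply: injf.
by rewrite fy (inj_eq perm_inj) eq_sym.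
Qed.

(** Composing one extension [s0] with the permutations supported off [A] gives all extensions: they
    form a coset of the group of those permutations. *)
Lemma card_perm_extending (T : finType) (A : {set T}) (f : T -> T) :
  #|[set s : {perm T} | [forall x in A, f x == s x]]| =
    if dinjectiveb f (mem A) then (#|T| - #|A|)`! else 0.
Proof.
case: dinjectiveP => [injf | ninjf]; last first.
  apply/eqP; rewrite cards_eq0; apply/eqP/setP => s; rewrite !inE.
  apply: contra_notF ninjf => /'forall_implyP fs x y Ax Ay.
  by rewrite (eqP (fs x Ax)) (eqP (fs y Ay)) => /perm_inj.
have [s0 fs0] := perm_extending _ _ _ injf.
have <- : #|~: A| = #|T| - #|A| by rewrite -(cardsC A) addKn.
rewrite -card_perm -(card_imset (mem (perm_on (~: A))) (@mulIg _ s0)).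
apply: eq_card => s; rewrite inE; apply/'forall_implyP/imsetP.
- move=> fs; exists (s * s0^-1)%g; last by rewrite mulgKV.
  apply/fintype.subsetP => x; rewrite !inE permM; apply: contra => Ax.
  by rewrite -(eqP (fs x Ax)) (fs0 x Ax) permK.
- case=> t tP -> x Ax; rewrite permM (out_perm tP) ?inE ?negbK //.
  by rewrite fs0.
Qed.

(** * Pairs of a Cayley permutation and a permutation *)

Lemma is_cayley_perm n (f : {ffun 'I_n -> 'I_n}) (s : {perm 'I_n}) :
  is_cayley [ffun x => f (s x)] = is_cayley f.
Proof.
rewrite /is_cayley.
have -> // : [ffun x => f (s x)] @: [set: 'I_n] = f @: [set: 'I_n].
apply/setP => y; apply/imsetP/imsetP => -[x _ ->].
  by exists (s x); rewrite ?ffunE.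
by exists ((s^-1)%g x); rewrite ?ffunE ?permKV.
Qed.

(** Every [s] contributes equally: [f] disagrees with [s] everywhere exactly when [f] after the
    inverse of [s] has no fixed point. *)
Lemma card_CayDer n :
  #|CayDer n| * n`! =
  \sum_(f in Cay n) #|[set s : {perm 'I_n} | [forall x, f x != s x]]|.
Proof.
under eq_bigr do rewrite -sum1_card.
under eq_bigr do under eq_bigl do rewrite inE.
rewrite (exchange_big_dep xpredT) //= mulnC -card_Sn -sum_nat_const.
rewrite [LHS](eq_bigl xpredT) //.
apply: eq_bigr => s _; rewrite -sum1_card.
pose h (t : {perm 'I_n}) (f : {ffun 'I_n -> 'I_n}) := [ffun x => f (t x)].
rewrite (reindex_onto (h s^-1%g) (h s)) /=; last first.
  by move=> f _; apply/ffunP => x; rewrite !ffunE permKV.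
apply: eq_bigl => f; rewrite !inE is_cayley_perm.
have -> : h s (h s^-1%g f) == f by apply/eqP/ffunP => x; rewrite !ffunE permK.
rewrite andbT; congr (_ && _).
apply/forallP/forallP => fP x; first by have := fP (s x); rewrite ffunE permK.
by have := fP (s^-1%g x); rewrite ffunE permKV.
Qed.

(** * Cayley permutations with a repeated value *)

Lemma cayleyP n (f : {ffun 'I_n -> 'I_n}) :
  reflect (exists2 k, k <= n & forall j : 'I_n, (j \in codom f) = (j < k))
          (is_cayley f).
Proof.
apply: (iffP existsP) => [[k /eqP fk] | [k lekn fk]].
- exists k => [|j]; first by rewrite -ltnS.
  have /setP/(_ j) := fk; rewrite inE => <-.
  by apply/codomP/imsetP => [[u ->] | [u _ ->]]; exists u.
- exists (Ordinal (lekn : k < n.+1)); apply/eqP/setP => j; rewrite inE -fk.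
  by apply/imsetP/codomP => [[u _ ->] | [u ->]]; exists u.
Qed.

Lemma fubini_gt0 n : 0 < fubini n.
Proof.
apply/card_gt0P; exists [ffun x => x]; rewrite inE; apply/cayleyP.
by exists n => // j; rewrite ltn_ord; apply/codomP; exists j; rewrite ffunE.
Qed.

(* Given [f a = f b] and a point [u], make [u] the only point of value 0 and
   let the remaining points carry the values of [f] off [a], shifted by 1. *)
Lemma card_Cay_collision n (a b : 'I_n) : a != b ->
  n * #|[set f in Cay n | f a == f b]| <= fubini n.
Proof.
case: n a b => [[] //|n] a b neq_ab.
set B := [set f in _ | _].
(* For [x] other than [u = p.1], [tperm a u x] is never [a], so exactly the values of [f] off [a]
   are used; [f a] still occurs, as [f b]. *)
pose h (p : 'I_n.+1 * {ffun 'I_n.+1 -> 'I_n.+1}) : {ffun 'I_n.+1 -> 'I_n.+1} :=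
  [ffun x => if x == p.1 then ord0 else inord (p.2 (tperm a p.1 x)).+1].
(* A map onto all [n.+1] values would be injective, so a collision leaves the top value free: the
   shift by 1 stays in range and [inord] never defaults. *)
have Bk f : f \in B ->
    exists2 k, k <= n & forall j : 'I_n.+1, (j \in codom f) = (j < k).
  rewrite !inE => /andP[/cayleyP[k lekn fk] /eqP fab]; exists k => //.
  rewrite leqNgt; apply/negP => ltnk.
  have /injectiveP injf : injectiveb f.
    rewrite /injectiveb /dinjectiveb -/(codom f).
    apply/card_uniqP; rewrite size_codom; apply: eq_card => j.
    by rewrite fk (leq_trans (ltn_ord j) ltnk).
  by rewrite (injf _ _ fab) eqxx in neq_ab.
have hE p x : p.2 \in B -> x != p.1 -> h p x = (p.2 (tperm a p.1 x)).+1 :> nat.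
  move=> /Bk[k lekn fk] /negPf neq; rewrite ffunE neq inordK //.
  by rewrite ltnS (leq_trans _ lekn) // -fk codom_f.
have h0 p : h p p.1 = ord0 by rewrite ffunE eqxx.
(* Inverts [h] once [u] is known; the value at [a] is read off at [b]. *)
have fE p x : p.2 \in B ->
    p.2 x = (h p (tperm a p.1 (if x == a then b else x))).-1 :> nat.
  move=> Bp; have -> : p.2 x = p.2 (if x == a then b else x).
    by case: eqP => // ->; move: Bp; rewrite !inE => /andP[_ /eqP].
  rewrite hE ?tpermK // -[X in _ != X](tpermL a) (inj_eq perm_inj).
  by case: (x =P a) => [_|/eqP//]; rewrite eq_sym.
have -> : n.+1 * #|B| = #|finset.setX [set: 'I_n.+1] B|.
  by rewrite cardsX cardsT card_ord.
rewrite -(card_in_imset (f := h)); last first.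
  case=> u f [v g] /finset.setXP[/= _ Bf] /finset.setXP[/= _ Bg] eqh.
  (* The point [u] is recovered as the only zero of [h (u, f)]. *)
  have uv : u = v.
    apply/eqP; apply: contraT => neq_uv.
    have := hE (v, g) u Bg neq_uv; rewrite -eqh /=.
    by rewrite (h0 (u, f)).
  subst v; congr pair; apply/ffunP => x; apply: val_inj => /=.
  by rewrite (fE (u, f)) // (fE (u, g)) // eqh.
apply/subset_leq_card/fintype.subsetP => _ /imsetP[[u f] /finset.setXP[/= _ Bf] ->].
have [k lekn fk] := Bk f Bf.
rewrite inE; apply/cayleyP; exists k.+1 => // j.
apply/codomP/idP => [[x ->] |].
  have [->|neq] := eqVneq x u; first by rewrite (h0 (u, f)).
  by rewrite (hE (u, f)) // ltnS -fk codom_f.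
case: (posnP j) => [j0 _|jgt0].
  by exists u; apply: val_inj; rewrite (h0 (u, f)).
rewrite -(prednK jgt0) ltnS => ltjk.
have ltjn : j.-1 < n.+1 by rewrite (leq_trans ltjk) // leqW.
have /codomP[x fx] : Ordinal ltjn \in codom f by rewrite fk.
exists (tperm a u (if x == a then b else x)); apply: val_inj => /=.
have := congr1 val fx; rewrite /= (fE (u, f)) //= => fx'.
rewrite -[LHS](prednK jgt0) fx' prednK //.
rewrite (hE (u, f)) //= -[X in _ != X](tpermL a) (inj_eq perm_inj).
by case: (x =P a) => [_|/eqP//]; rewrite eq_sym.
Qed.

(** Union bound over the ordered pairs of distinct points of [A]. *)
Lemma card_Cay_noninj n (A : {set 'I_n}) :
  n * #|[set f in Cay n | ~~ dinjectiveb f (mem A)]| <=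
    #|A| * #|A|.-1 * fubini n.
Proof.
have -> : #|A| * #|A|.-1 * fubini n =
    \sum_(a in A) \sum_(b in A :\ a) fubini n.
  rewrite -mulnA -sum_nat_const; apply: eq_bigr => a Aa.
  by rewrite sum_nat_const (cardsD1 a A) Aa.
have le_ab a : \sum_(b in A :\ a) n * #|[set f in Cay n | f a == f b]| <=
    \sum_(b in A :\ a) fubini n.
  apply: leq_sum => b /setD1P[neq_ba _].
  by apply: card_Cay_collision; rewrite eq_sym.
apply: leq_trans (leq_sum _ (fun a _ => le_ab a)).
under eq_bigr do rewrite -big_distrr.
rewrite -big_distrr leq_mul2l /=; apply/orP; right.
under eq_bigr do under eq_bigr do rewrite -sum1dep_card big_mkcondr /=.
under eq_bigr do rewrite exchange_big /=.
rewrite exchange_big -sum1dep_card big_mkcondr /=.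
apply: leq_sum => f _; case: ifP => // /dinjectivePn[a Aa [b]].
rewrite inE => /andP[neq_ba Ab] fab.
rewrite (bigD1 a) //= (bigD1 b) /= ?inE ?neq_ba //.
by rewrite fab eqxx.
Qed.

(** * Inclusion-exclusion *)

Local Open Scope ring_scope.

Lemma disagree_inclusion_exclusion (K : comNzRingType) (T : finType)
    (f g : T -> T) :
  [forall x, f x != g x]%:R =
  \sum_(A : {set T}) (-1) ^+ #|A| * [forall x in A, f x == g x]%:R :> K.
Proof.
(* Each factor is 0 or 1, and distributing the product gives one term per subset [A]. *)
transitivity (\prod_x (- (f x == g x)%:R + 1 : K)).
  have [/forallP fg|/forallPn[x]] := boolP [forall x, f x != g x].
    by rewrite big1 // => x _; rewrite (negPf (fg x)) oppr0 add0r.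
  by rewrite negbK => fg; rewrite (bigD1 x) //= fg addNr mul0r.
rewrite bigA_distr; apply: eq_bigr => A _; rewrite -big_mkcond /=.
rewrite prodrN; congr (_ * _).
have [/'forall_implyP fg|] := boolP [forall x in A, f x == g x].
  by rewrite big1 // => x Ax; rewrite (fg x Ax).
rewrite negb_forall => /existsP[x]; rewrite negb_imply => /andP[Ax nfg].
by rewrite (bigD1 x) //= (negPf nfg) mul0r.
Qed.

(** For fixed [A] and [f], summing over [s] first counts the permutations that extend [f] from
    [A]. *)
Lemma CayDer_inclusion_exclusion (K : comNzRingType) n :
  (#|CayDer n| * n`!)%:R =
  \sum_(A : {set 'I_n}) (-1) ^+ #|A| *
    (#|[set f in Cay n | dinjectiveb f (mem A)]| * (n - #|A|)`!)%:R :> K.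
Proof.
rewrite card_CayDer natr_sum.
under eq_bigr => f _.
  rewrite -sum1dep_card big_mkcond natr_sum /=.
  under eq_bigr => s _.
    rewrite (_ : (if _ then _ else _)%:R =
                 \sum_(A : {set 'I_n}) (-1) ^+ #|A| *
                    [forall x in A, f x == s x]%:R); last first.
      by rewrite -disagree_inclusion_exclusion; case: ifP.
    over.
  rewrite exchange_big; over.
rewrite exchange_big; apply: eq_bigr => A _ /=.
under eq_bigr do rewrite -big_distrr -natr_sum /=.
rewrite -big_distrr -natr_sum /=; congr (_ * _%:R).
rewrite -sum1dep_card big_mkcondr big_distrl /=; apply: eq_bigr => f _.
transitivity #|[set s : {perm 'I_n} | [forall x in A, f x == s x]]|.
  rewrite -sum1dep_card [RHS]big_mkcond; apply: eq_bigr => s _ /=.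
  by case: [forall x in A, f x == s x].
by rewrite card_perm_extending card_ord; case: ifP; rewrite ?mul1n.
Qed.

(** * Comparison with the exponential series *)

Lemma sum_sets_by_card (K : nzSemiRingType) n (G : nat -> K) :
  \sum_(A : {set 'I_n}) G #|A| = \sum_(j < n.+1) 'C(n, j)%:R * G j.
Proof.
have ltA (A : {set 'I_n}) : (#|A| < n.+1)%N.
  by rewrite ltnS -[X in (_ <= X)%N](card_ord n) max_card.
rewrite (partition_big (fun A : {set 'I_n} => Ordinal (ltA A)) xpredT) //=.
apply: eq_bigr => j _.
rewrite (eq_bigr (fun=> G j)) => [|A /eqP <- //].
rewrite sumr_const mulr_natl.
have -> : 'C(n, j) = #|[set A : {set 'I_n} | #|A| == j]|.
  by rewrite card_draws card_ord.
by congr (_ *+ _); apply: eq_card => A; rewrite inE -topredE.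
Qed.

(** There are ['C(n, j)] sets of size [j], and ['C(n, j) * (n - j)! / n!] is [1 / j!]. *)
Lemma sum_sets_card_fact (K : numFieldType) n (G : nat -> K) :
  \sum_(A : {set 'I_n}) G #|A| * (n - #|A|)`!%:R / n`!%:R =
  \sum_(0 <= j < n.+1) G j / j`!%:R.
Proof.
rewrite (sum_sets_by_card _ _ (fun j => G j * (n - j)`!%:R / n`!%:R)) big_mkord.
apply: eq_bigr => j _.
have nz k : k`!%:R != 0 :> K by rewrite pnatr_eq0 -lt0n fact_gt0.
have le_jn : (j <= n)%N by rewrite -ltnS.
rewrite -(bin_fact le_jn) !natrM; field.
by rewrite !nz pnatr_eq0 -lt0n bin_gt0.
Qed.

Lemma CayDer_fubini_dist (R : realType) n : (0 < n)%N ->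
  `|#|CayDer n|%:R / (fubini n)%:R - series (exp_coeff (- 1)) n.+1| <=
    expR 1 / n%:R :> R.
Proof.
move=> n_gt0.
pose B (A : {set 'I_n}) := #|[set f in Cay n | ~~ dinjectiveb f (mem A)]|.
have F_gt0 : 0 < (fubini n)%:R :> R by rewrite ltr0n fubini_gt0.
have fact_gt0R k : 0 < k`!%:R :> R by rewrite ltr0n fact_gt0.
have n_gt0R : 0 < n%:R :> R by rewrite ltr0n.
have BE (A : {set 'I_n}) : #|[set f in Cay n | dinjectiveb f (mem A)]|%:R =
    (fubini n)%:R - (B A)%:R :> R.
  apply/eqP; rewrite eq_sym subr_eq -natrD; apply/eqP; congr _%:R.
  rewrite /fubini -(cardsID [set f : {ffun _} | dinjectiveb f (mem A)] (Cay n)).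
  by congr (_ + _)%N; apply: eq_card => f; rewrite !inE // andbC.
(* The proportion injective on [A] is [1 - B A / fubini n]; its part 1 sums to the partial series
   and cancels. *)
have -> : #|CayDer n|%:R / (fubini n)%:R - series (exp_coeff (- 1)) n.+1 =
    - \sum_(A : {set 'I_n}) (-1) ^+ #|A| * ((B A)%:R / (fubini n)%:R) *
        (n - #|A|)`!%:R / n`!%:R :> R.
  have -> : #|CayDer n|%:R / (fubini n)%:R =
      \sum_(A : {set 'I_n}) (-1) ^+ #|A| * (1 - (B A)%:R / (fubini n)%:R) *
        (n - #|A|)`!%:R / n`!%:R :> R.
    apply: (mulIf (lt0r_neq0 F_gt0)); apply: (mulIf (lt0r_neq0 (fact_gt0R n))).
    rewrite mulfVK ?lt0r_neq0 // -natrM CayDer_inclusion_exclusion.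
    rewrite !big_distrl; apply: eq_bigr => A _ /=.
    rewrite natrM BE; field.
    by rewrite !lt0r_neq0.
  rewrite /series /exp_coeff /= -(sum_sets_card_fact _ _ (fun j => (-1) ^+ j)).
  rewrite -sumrB -sumrN; apply: eq_bigr => A _; ring.
rewrite normrN (le_trans (ler_norm_sum _ _ _)) //.
apply: (@le_trans _ _ (\sum_(A : {set 'I_n}) (#|A| * #|A|.-1)%:R / n%:R *
        (n - #|A|)`!%:R / n`!%:R)).
  apply: ler_sum => A _; rewrite !normrM normrX normrN1 expr1n mul1r.
  rewrite !normfV !normr_nat !ler_wpM2r ?invr_ge0 ?ler0n //.
  rewrite ler_pdivrMr // mulrAC ler_pdivlMr // -!natrM ler_nat mulnC.
  exact: card_Cay_noninj.
rewrite (sum_sets_card_fact _ _ (fun j => (j * j.-1)%:R / n%:R)).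
under eq_bigr do rewrite mulrAC.
rewrite -big_distrl ler_wpM2r ?invr_ge0 ?ler0n //=.
apply: (@le_trans _ _ (series (exp_coeff 1) n.+1)); last first.
  apply: nondecreasing_cvgn_le; last exact: is_cvg_series_exp_coeff.
  by apply: nondecreasing_series => k _ _; apply: exp_coeff_ge0.
(* The terms [j = 0] and [j = 1] vanish, and [j (j - 1) / j! = 1 / (j - 2)!] for the others, so the
   sum is the partial series of [expR 1] without its last two terms. *)
case: n n_gt0 {B F_gt0 n_gt0R BE} => // n _.
rewrite big_nat_recl // big_nat_recl // !mul0r !add0r /series /=.
rewrite [leRHS]big_nat_recr //= -[leLHS]addr0 lerD ?exp_coeff_ge0 //.
rewrite [leRHS]big_nat_recr //= -[leLHS]addr0 lerD ?exp_coeff_ge0 //.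
apply: ler_sum => j _; rewrite /exp_coeff /= expr1n !factS !natrM.
rewrite le_eqVlt; apply/orP; left; apply/eqP; field.
by rewrite !lt0r_neq0.
Qed.

Local Open Scope classical_set_scope.

Theorem theorem6p1 (R : realType) :
  (fun n : nat => #|CayDer n|%:R / (fubini n)%:R : R) @ \oo --> 1 / expR (1 : R).
Proof.
(* The distance bound needs a positive index; after the shift it reads [expR 1 * harmonic n], and
   the partial sum has [n.+2] terms. *)
rewrite -cvg_shiftS div1r -expRN.
pose S n : R := series (exp_coeff (- 1)) n.+2.
apply: (cvg_sub0 (g := S)); last first.
  rewrite (cvg_shiftS (fun n => series (exp_coeff (- 1)) n.+1)) cvg_shiftS.
  exact: is_cvg_series_exp_coeff.
apply: norm_cvg0.
apply: (squeeze_cvgr (f := fun=> 0) (h := fun n => expR 1 * harmonic n)).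
- by near=> n; rewrite normr_ge0 /=; apply: CayDer_fubini_dist.
- exact: cvg_cst.
- rewrite -[X in _ --> X](mulr0 (expR 1)); apply: cvgMr.
  exact: cvg_harmonic.
Unshelve. all: by end_near.
Qed.
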